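(* For $\mathcal{R}=\frac{GR(p^a,m)[x]}{\langle f(x)\rangle}$ the following hold: (1) $\mathcal{R}=\bigoplus_{i=1}^s\langle\hat f_i(x)+\langle f\rangle\rangle$ and $\langle\hat f_i(x)+\langle f\rangle\rangle\cong\frac{GR(p^a,m)[x]}{\langle f_i(x)\rangle}$ for $1\le i\le s$. (2) Any maximal ideal of $\mathcal{R}$ is of the form $$\langle p\hat f_i(x)+f_i(x)+\langle f\rangle,\ h_i(x)\hat f_i(x)+f_i(x)+\langle f\rangle\rangle=\langle p+\langle f\rangle,\ h_i(x)+\langle f\rangle\rangle$$ for some $1\le i\le s$. (3) $J(\mathcal{R})=\bigcap_{i=1}^s\langle p+\langle f\rangle,h_i(x)+\langle f\rangle\rangle=\left\langle p+\langle f\rangle,\ \prod_{i=1}^sh_i(x)+\langle f\rangle\right\rangle$. (4) $\mathrm{soc}(\mathcal{R})=\bigoplus_{i=1}^s\langle p^{a-1}h_i(x)^{t_i-1}\hat f_i(x)+\langle f\rangle\rangle=\left\langle p^{a-1}\prod_{i=1}^sh_i(x)^{t_i-1}+\langle f\rangle\right\rangle$.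
   Context: $p$ is a prime, $a,m\ge1$; $GR(p^a,m)$ is the Galois ring of characteristic $p^a$ with $p^{am}$ elements, with maximal ideal $\langle p\rangle$ and residue field $\mathbb{F}_{p^m}$; a bar denotes reduction modulo $p$. $\mathcal{T}_m\subset GR(p^a,m)$ is the Teichmüller set $\{0,1,\zeta,\dots,\zeta^{p^m-2}\}$ ($\zeta$ of multiplicative order $p^m-1$), identified with $\mathbb{F}_{p^m}$. A polynomial is regular if it is not a zero divisor, primary if it generates a primary ideal, basic irreducible if it is irreducible with irreducible reduction modulo $p$; two polynomials are coprime if they generate the unit ideal. $J$ denotes the Jacobson radical (intersection of all maximal ideals) and $\mathrm{soc}$ the socle (sum of all minimal nonzero ideals). Standing assumption: $f(x)\in GR(p^a,m)[x]$ is a regular monic polynomial with $f(x)=f_1(x)\cdots f_s(x)$, where the $f_i(x)$ are regular primary pairwise coprime non-unit polynomials of the form $f_i(x)=h_i(x)^{t_i}+p\beta_i(x)$, $h_i(x)$ monic basic irreducible with $\overline{h_i}(x)=h_i(x)$ (coefficients in $\mathcal{T}_m$), $t_i\ge1$ and $\deg\beta_i(x)<t_i\deg h_i(x)$. (Every regular polynomial is, up to a unit, such a product.) $\hat f_i(x)=\prod_{j\ne i}f_j(x)$. In (1) the ideal $\langle\hat f_i(x)+\langle f\rangle\rangle$ is generated by an idempotent, and the isomorphism is one of rings with that idempotent as identity of the ideal. *)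

(* Defs.v *)
From HB Require Import structures.
From mathcomp Require Import all_boot all_order all_algebra.
From mathcomp Require Import boolp classical_sets functions.

Set Implicit Arguments.
Unset Strict Implicit.
Unset Printing Implicit Defensive.

Import GRing.Theory.

Local Open Scope classical_set_scope.
Local Open Scope ring_scope.

Section CommutativeRings.
Variable A : comPzRingType.
Implicit Types (I J : set A) (x y : A).

Definition is_ideal I : Prop :=
  [/\ I 0, forall x y, I x -> I y -> I (x + y) & forall x y, I y -> I (x * y)].

Definition ideal_gen (S : set A) : set A := smallest is_ideal S.

Definition maximal_ideal I : Prop :=
  [/\ is_ideal I, I <> setT
    & forall J, is_ideal J -> I `<=` J -> J = I \/ J = setT].

Definition minimal_ideal I : Prop :=
  [/\ is_ideal I, I <> [set 0]
    & forall J, is_ideal J -> J `<=` I -> J = [set 0] \/ J = I].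

Definition primary_ideal I : Prop :=
  [/\ is_ideal I, I <> setT
    & forall x y, I (x * y) -> I x \/ exists2 n, (0 < n)%N & I (y ^+ n)].

Definition jacobson : set A := \bigcap_(I in maximal_ideal) I.

(* Sum of an arbitrary family of ideals: the finite sums of elements taken
   from members of the family. *)
Definition ideal_sum (D : set (set A)) : set A :=
  [set x | exists2 r : seq A,
     (forall y, y \in r -> exists2 I, D I & I y) & x = \sum_(y <- r) y].

Definition socle : set A := ideal_sum minimal_ideal.

(* M is the internal direct sum of the I i. *)
Definition is_direct_sum (s : nat) (I : 'I_s -> set A) (M : set A) : Prop :=
  M = [set x | exists2 y : 'I_s -> A, forall i, I i (y i) & x = \sum_i y i] /\
  (forall y : 'I_s -> A, (forall i, I i (y i)) ->
     \sum_i y i = 0 -> forall i, y i = 0).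

Definition is_unit x : Prop := exists y, x * y = 1.

Definition irreducible_elt x : Prop :=
  ~ is_unit x /\ forall y z, x = y * z -> is_unit y \/ is_unit z.

Definition primary_elt x : Prop := primary_ideal (ideal_gen [set x]).

Definition coprime_elts x y : Prop := ideal_gen [set x; y] = setT.

End CommutativeRings.

Arguments jacobson : clear implicits.
Arguments socle : clear implicits.

(* The ideal I of A, regarded as a ring with identity e, is isomorphic to B;
   only the restriction of phi to I matters. *)
Definition ideal_ring_iso (A B : comPzRingType) (I : set A) (e : A) : Prop :=
  exists phi : A -> B,
    [/\ forall x y, I x -> I y -> phi (x + y) = phi x + phi y,
        forall x y, I x -> I y -> phi (x * y) = phi x * phi y,
        phi e = 1
      & set_bij I setT phi].

(* These properties determine GR(p^a, m) up to isomorphism. *)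
Definition is_galois_ring (p a m : nat) (R : finComNzRingType) : Prop :=
  [/\ forall n : nat, (n%:R == 0 :> R) = (p ^ a %| n)%N,
      #|R| = (p ^ (a * m))%N
    & forall I : set R, maximal_ideal I <-> I = ideal_gen [set p%:R]].

(* bar exhibits F as the residue field R / <p>. *)
Definition is_reduction_mod (p : nat) (R : comNzRingType) (F : fieldType)
    (bar : {rmorphism R -> F}) : Prop :=
  (forall y : F, exists x : R, bar x = y) /\
  (forall x : R, bar x = 0 <-> ideal_gen [set p%:R] x).

Definition teichmuller (p m : nat) (R : finComNzRingType) (zeta : R) : {pred R} :=
  [pred x | (x == 0) || [exists i : 'I_(p ^ m - 1), x == zeta ^+ i]].

Definition basic_irreducible (R : comNzRingType) (F : fieldType)
    (bar : {rmorphism R -> F}) (h : {poly R}) : Prop :=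
  irreducible_elt h /\ irreducible_poly (map_poly bar h).

Definition cofactor_poly (R : comNzRingType) (s : nat) (g : 'I_s -> {poly R})
    (i : 'I_s) : {poly R} := \prod_(j < s | j != i) g j.

(* Main.v *)
Require Import Defs.
From HB Require Import structures.
From mathcomp Require Import all_boot all_order all_algebra ring.
From mathcomp Require Import boolp classical_sets functions.

(** Write [Q = R[x] / <f>] and [fhat i] for the product of the [fi j], [j != i].

    The pairwise coprime factors split [Q] by the Chinese remainder theorem:
    a Bezout relation between [fi i] and [fhat i] makes a multiple of [fhat i]
    an idempotent [e i] that generates the same ideal, and the [e i] are
    orthogonal with sum 1 ([crt_idempotents], [qpoly_components]).

    The remaining parts are read off from two descriptions of ideals of [Q] in
    terms of divisibility in [F[x]], where a bar is reduction modulo [p] and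
    the bar of [h] divides the bar of [f]:
    - [g] lies in [<p, h>] iff the bar of [h] divides the bar of [g]
      ([mem_gen_p]);
    - [p ^ (a - 1) g] lies in [<p ^ (a - 1) h>] iff the bar of [h] divides the
      bar of [g] ([mem_gen_pred_pX]).
    The second one rests on the fact that in [R] the annihilator of [p] is
    generated by [p ^ (a - 1)] and the annihilator of [p ^ (a - 1)] by [p].
    Both pass to [Q], which is free over [R] because [f] is monic.

    The bar of [f] is the product of the powers of exponent [t i] of the bars
    of the [h i], which are irreducible and pairwise coprime. Thus [p] and
    [\prod_i h i] are nilpotent in [Q]. A maximal ideal contains both, hence
    some [<p, h i>], which is itself maximal; the Jacobson radical is the
    intersection of these ideals, and [mem_gen_p] turns that intersection into
    divisibility by the product of the coprime [h i]. Dually, a minimal ideal is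
    annihilated by both nilpotent elements, so it consists of multiples
    [p ^ (a - 1) g] with [g] divisible, modulo [p], by the product of the
    [h i ^ (t i - 1)]. This bounds the socle from above; the idempotents [e i]
    split the bounding ideal into the ideals
    [<p ^ (a - 1) h i ^ (t i - 1) fhat i>], and each of those is minimal. *)

Import GRing.Theory.
Local Open Scope classical_set_scope.
Local Open Scope ring_scope.

Set Implicit Arguments.
Unset Strict Implicit.
Unset Printing Implicit Defensive.

(** * Ideals of a commutative ring *)

Section Ideals.
Variable A : comNzRingType.
Implicit Types (I J M : set A) (x y z : A).

Lemma ideal_gen_ideal (S : set A) : is_ideal (ideal_gen S).
Proof.
split=> [J [[]] //|x y Ix Iy J [idJ SJ]|x y Iy J [idJ SJ]].
  by have [_ JD _] := idJ; apply: JD; [apply: Ix|apply: Iy].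
by have [_ _ JM] := idJ; apply: JM; apply: Iy.
Qed.

Lemma idealB I x y : is_ideal I -> I x -> I y -> I (x - y).
Proof.
by case=> _ ID IM Ix Iy; apply: ID => //; rewrite -mulN1r; apply: IM.
Qed.

Lemma ideal_full I : is_ideal I -> I 1 -> I = setT.
Proof.
by case=> _ _ IM I1; rewrite -subTset => x _; rewrite -(mulr1 x); apply: IM.
Qed.

Lemma ideal_gen1E x y : ideal_gen [set x] y <-> exists u, y = u * x.
Proof.
split; last first.
  move=> [u ->]; have [_ _ IM] := ideal_gen_ideal [set x].
  by apply: IM; apply: sub_gen_smallest.
apply: (smallest_sub (X := [set y | exists u, y = u * x])) => [|_ ->].
  split=> [|_ _ [u ->] [v ->]|z _ [u ->]] /=; first by exists 0; rewrite mul0r.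
    by exists (u + v); rewrite mulrDl.
  by exists (z * u); rewrite mulrA.
by exists 1; rewrite mul1r.
Qed.

Lemma ideal_gen2E x z y :
  ideal_gen [set x; z] y <-> exists u v, y = u * x + v * z.
Proof.
split; last first.
  move=> [u [v ->]]; have [_ ID IM] := ideal_gen_ideal [set x; z].
  by apply: ID; apply: IM; apply: sub_gen_smallest; [left|right].
apply: (smallest_sub (X := [set y | exists u v, y = u * x + v * z])).
  split=> [|_ _ [u [v ->]] [u' [v' ->]]|w _ [u [v ->]]] /=.
  - by exists 0, 0; rewrite !mul0r addr0.
  - by exists (u + u'), (v + v'); ring.
  - by exists (w * u), (w * v); ring.
move=> _ [->|->]; first by exists 1, 0; rewrite mul1r mul0r addr0.
by exists 0, 1; rewrite mul1r mul0r add0r.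
Qed.

Lemma ideal_gen_eq (S T : set A) :
  S `<=` ideal_gen T -> T `<=` ideal_gen S -> ideal_gen S = ideal_gen T.
Proof.
by move=> ST TS; rewrite eqEsubset; split; apply: smallest_sub => //;
  apply: ideal_gen_ideal.
Qed.

Lemma mem_ideal_gen1 x : ideal_gen [set x] x.
Proof. exact: sub_gen_smallest. Qed.
Arguments mem_ideal_gen1 : clear implicits.

Lemma coprime_eltsP x y :
  coprime_elts x y <-> exists u v, u * x + v * y = 1.
Proof.
split=> [xy|[u [v uv]]].
  have /ideal_gen2E[u [v ->]] : ideal_gen [set x; y] 1 by rewrite xy.
  by exists u, v.
by apply: ideal_full (ideal_gen_ideal _) _; apply/ideal_gen2E; exists u, v.
Qed.

Lemma coprime_elts_prod (T : eqType) (r : seq T) (P : pred T) x (g : T -> A) :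
  (forall j, P j -> coprime_elts x (g j)) ->
  coprime_elts x (\prod_(j <- r | P j) g j).
Proof.
move=> cop; apply/coprime_eltsP; elim/big_rec: _ => [|j z Pj [u [v uv]]].
  by exists 0, 1; rewrite mul0r mul1r add0r.
have /coprime_eltsP[u' [v' uv']] := cop j Pj.
exists (u * u' * x + u * v' * g j + v * z * u'), (v * v').
by rewrite -[1]mulr1 -{1}uv -uv'; ring.
Qed.

Lemma maximal_prime M x y : maximal_ideal M -> M (x * y) -> M x \/ M y.
Proof.
move=> [idM MT maxM] Mxy; have [M0 MD MM] := idM.
have [Mx|nMx] := pselect (M x); [by left|right].
pose J := [set z | exists2 w, M w & exists u, z = w + u * x].
have idJ : is_ideal J.
  split=> [|_ _ [w Mw [u ->]] [w' Mw' [u' ->]]|z _ [w Mw [u ->]]].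
  - by exists 0 => //; exists 0; rewrite mul0r addr0.
  - by exists (w + w'); [apply: MD|exists (u + u'); ring].
  - by exists (z * w); [apply: MM|exists (z * u); ring].
have MJ : M `<=` J.
  by move=> w Mw; exists w => //; exists 0; rewrite mul0r addr0.
have Jx : J x by exists 0 => //; exists 1; rewrite mul1r add0r.
have [JM|JT] := maxM J idJ MJ; first by rewrite JM in Jx.
have [w Mw [u uE]] : J 1 by rewrite JT.
rewrite -(mulr1 y) uE mulrDr; apply: MD; first exact: MM.
by rewrite mulrCA [y * x]mulrC; apply: MM.
Qed.

Lemma maximal_nilpotent M x n : maximal_ideal M -> x ^+ n = 0 -> M x.
Proof.
move=> maxM xn0; have [[M0 MD MM] MT _] := maxM.
have : M (x ^+ n) by rewrite xn0.
elim: n {xn0} => [|n IHn].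
  by rewrite expr0 => /(ideal_full (And3 M0 MD MM)).
by rewrite exprS => /(maximal_prime maxM)[].
Qed.

Lemma maximal_ideal_crit I : is_ideal I -> ~ I 1 ->
  (forall x, ~ I x -> exists u, I (1 - u * x)) -> maximal_ideal I.
Proof.
move=> idI nI1 invI; split=> // [IT|J idJ IJ]; first by apply: nI1; rewrite IT.
have [JI|/existsNP[x /not_implyP[Jx nIx]]] := pselect (forall x, J x -> I x).
  by left; rewrite eqEsubset.
right; apply: ideal_full => //; have [u /IJ Ju] := invI x nIx.
have [_ JD JM] := idJ; rewrite -(subrK (u * x) 1).
by apply: JD => //; apply: JM.
Qed.

Lemma minimal_ideal_gen1 x : x != 0 ->
  (forall c, c * x != 0 -> exists u, x = u * (c * x)) ->
  minimal_ideal (ideal_gen [set x]).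
Proof.
move=> x0 divx; split; first exact: ideal_gen_ideal.
  move=> I0; have := mem_ideal_gen1 x; rewrite I0 => /= /eqP.
  by rewrite (negPf x0).
move=> J idJ Jx; have [J0 _ JM] := idJ.
have [J00|/existsNP[y /not_implyP[Jy ny0]]] := pselect (forall y, J y -> y = 0).
  by left; rewrite eqEsubset; split=> // y ->.
right; rewrite eqEsubset; split=> // z /ideal_gen1E[w ->]; apply: (JM).
have /ideal_gen1E[c yE] := Jx y Jy; rewrite yE in Jy ny0.
by have [u xE] := divx c (introN eqP ny0); rewrite xE; apply: JM.
Qed.

(** The ideal [x I] is contained in [I]; were it equal to [I], then
    [I = x ^ n I = 0]. *)
Lemma minimal_nilpotent I x y n :
  minimal_ideal I -> x ^+ n = 0 -> I y -> x * y = 0.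
Proof.
move=> [idI _ minI] xn0 Iy; have [I0 ID IM] := idI.
pose J := [set z | exists2 w, I w & z = x * w].
have idJ : is_ideal J.
  split=> [|_ _ [w Iw ->] [w' Iw' ->]|z _ [w Iw ->]].
  - by exists 0; rewrite ?mulr0.
  - by exists (w + w'); [apply: ID|rewrite mulrDr].
  - by exists (z * w); [apply: IM|rewrite mulrCA].
have JI : J `<=` I by move=> _ [w Iw ->]; apply: IM.
have [J0|JE] := minI J idJ JI.
  have : J (x * y) by exists y.
  by rewrite J0.
have Ipow k z : I z -> exists w, z = x ^+ k * w.
  elim: k z => [|k IHk] z Iz; first by exists z; rewrite mul1r.
  have [w /IHk[w' ->] ->] : J z by rewrite JE.
  by exists w'; rewrite exprS mulrA.
by have [w ->] := Ipow n y Iy; rewrite xn0 mul0r mulr0.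
Qed.

Lemma socle_minimal I : minimal_ideal I -> I `<=` socle A.
Proof.
move=> minI x Ix; exists [:: x]; last by rewrite big_seq1.
by move=> y; rewrite inE => /eqP->; exists I.
Qed.

Lemma socle_sum s (y : 'I_s -> A) : (forall i, socle A (y i)) ->
  socle A (\sum_i y i).
Proof.
move=> socy; apply: big_ind => // [|_ _ [r rP ->] [r' rP' ->]].
  by exists [::]; rewrite ?big_nil.
exists (r ++ r'); last by rewrite big_cat.
by move=> z; rewrite mem_cat => /orP[/rP|/rP'].
Qed.

Lemma socle_sub J : is_ideal J ->
  (forall I, minimal_ideal I -> I `<=` J) -> socle A `<=` J.
Proof.
move=> [J0 JD _] minJ _ [r rP ->]; rewrite big_seq.
by apply: big_ind => // y /rP[I minI Iy]; apply: minJ Iy.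
Qed.

(** As [g] and [g'] are coprime with product 0, the ideals may be compared
    modulo [g] and modulo [g']. Modulo [g], the generators on the left are
    [x] and [y] times the unit [g']; modulo [g'] each of them is the unit [g],
    which the ideal on the right contains. *)
Lemma ideal_gen2_twist g g' x y : coprime_elts g g' -> g * g' = 0 ->
  ideal_gen [set x; y] g ->
  ideal_gen [set x * g' + g; y * g' + g] = ideal_gen [set x; y].
Proof.
move=> /coprime_eltsP[u [v uv]] gg'0 xyg.
set I := ideal_gen [set x * _ + _; _]; have idI : is_ideal I.
  exact: ideal_gen_ideal.
have idxy := ideal_gen_ideal [set x; y].
have [_ ID IM] := idI; have [_ xyD xyM] := idxy.
have gI z : I (z * g' + g) -> I g /\ I z.
  move=> Iz; have Ig : I g.
    have gE : g = u * g * (z * g' + g) + (v - u * z) * (g * g').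
      by rewrite -{1}[g]mul1r -uv; ring.
    by rewrite gE gg'0 mulr0 addr0; apply: IM.
  split=> //; rewrite -[z]mul1r -uv.
  have -> : (u * g + v * g') * z = v * (z * g' + g) + (u * z - v) * g by ring.
  by apply: ID; apply: IM.
apply: ideal_gen_eq => _ [->|->].
- apply: xyD => //; rewrite mulrC; apply: xyM.
  by apply: sub_gen_smallest; left.
- apply: xyD => //; rewrite mulrC; apply: xyM.
  by apply: sub_gen_smallest; right.
- by have [] := gI x; [apply: sub_gen_smallest; left|].
- by have [] := gI y; [apply: sub_gen_smallest; right|].
Qed.

End Ideals.

(** * Orthogonal idempotents and the Chinese remainder theorem *)

Section Idempotents.
Variables (A : comNzRingType) (s : nat).

Section DirectSum.
Variables (e : 'I_s -> A) (I : 'I_s -> set A).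
Hypothesis e_orth : forall i j, i != j -> e i * e j = 0.
Hypothesis e_idem : forall i, e i * e i = e i.
Hypothesis I_sub : forall i, I i `<=` ideal_gen [set e i].

(** Multiplication by [e i] is the identity on [I i] and kills the other
    summands. *)
Lemma idem_component (y : 'I_s -> A) i : (forall j, I j (y j)) ->
  e i * \sum_j y j = y i.
Proof.
move=> Iy; rewrite mulr_sumr (bigD1 i) //= big1 ?addr0 => [|j ji].
  by have /ideal_gen1E[u ->] := I_sub (Iy i); rewrite mulrCA e_idem.
have /ideal_gen1E[u ->] := I_sub (Iy j).
by rewrite mulrCA e_orth ?mulr0 // eq_sym.
Qed.

Lemma direct_sum_idem (M : set A) :
  (forall y, (forall i, I i (y i)) -> M (\sum_i y i)) ->
  (forall x, M x -> exists2 y, forall i, I i (y i) & x = \sum_i y i) ->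
  is_direct_sum I M.
Proof.
move=> IM MI; split=> [|y Iy y0 i]; last first.
  by rewrite -(idem_component i Iy) y0 mulr0.
by rewrite eqEsubset; split=> x; [apply: MI|move=> [y Iy ->]; apply: IM].
Qed.
End DirectSum.

Variables (g : 'I_s -> A).
Hypothesis g_coprime : forall i j, i != j -> coprime_elts (g i) (g j).
Hypothesis g_prod0 : \prod_i g i = 0.

Let ghat i := \prod_(j | j != i) g j.

Lemma mul_cofactor i : g i * ghat i = 0.
Proof. by rewrite -g_prod0 [RHS](bigD1 i). Qed.

Lemma coprime_cofactor i : coprime_elts (g i) (ghat i).
Proof.
by apply: coprime_elts_prod => j ji; apply: g_coprime; rewrite eq_sym.
Qed.

(** The idempotent [e i] is the multiple [v i * ghat i] that a Bezout relation
    [u * g i + v * ghat i = 1] provides. The idempotents add up to 1 because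
    their sum [E] satisfies [e i * E = e i] for all [i], whence
    [1 - E = \prod_i (1 - e i) * (1 - E)], a multiple of [\prod_i g i = 0]. *)
Lemma crt_idempotents : exists e u v : 'I_s -> A,
  [/\ forall i, e i = v i * ghat i, forall i, 1 - e i = u i * g i,
      forall i, e i * e i = e i, forall i j, i != j -> e i * e j = 0
    & \sum_i e i = 1].
Proof.
have /choice[uv uvP] i : exists w : A * A, w.1 * g i + w.2 * ghat i = 1.
  by have /coprime_eltsP[u [v uv]] := coprime_cofactor i; exists (u, v).
pose e i := (uv i).2 * ghat i; pose u i := (uv i).1.
have e1 i : 1 - e i = u i * g i by rewrite -(uvP i) addrK.
have ge0 i : g i * e i = 0 by rewrite mulrCA mul_cofactor mulr0.
have ee i : e i * e i = e i.
  apply/eqP; rewrite eq_sym -subr_eq0 -{1}[e i]mul1r -mulrBl.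
  by rewrite e1 -mulrA ge0 mulr0.
have eO i j : i != j -> e i * e j = 0.
  move=> ij; have [w ->] : exists w, e j = g i * w.
    by rewrite /e /ghat (bigD1 i ij) /= mulrCA; eexists.
  by rewrite mulrCA mulrA ge0 mul0r.
exists e, u, (fun i => (uv i).2); split=> //.
pose E := \sum_i e i; have eE i : e i * (1 - E) = 0.
  rewrite mulrBr mulr1 mulr_sumr (bigD1 i) //= ee big1 ?addr0 ?subrr // => j ji.
  by rewrite eO // eq_sym.
suff : (\prod_i (1 - e i)) * (1 - E) = 1 - E.
  rewrite (eq_bigr _ (fun i _ => e1 i)) big_split /= g_prod0 mulr0 mul0r.
  by move/eqP; rewrite eq_sym subr_eq0 eq_sym => /eqP.
apply: (big_ind (fun z => z * (1 - E) = 1 - E)); first by rewrite mul1r.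
  by move=> x y xE yE; rewrite -mulrA yE.
by move=> i _; rewrite mulrBl mul1r eE subr0.
Qed.
End Idempotents.

(** A surjection [A -> B] with kernel [g A] restricts to a bijection on the
    complementary ideal [e A], where [1 - e] is a multiple of [g] and
    [e * g = 0]. *)
Lemma ideal_ring_iso_idem (A B : comNzRingType) (phi : A -> B) (e g u : A) :
  {morph phi : x y / x + y} -> {morph phi : x y / x * y} -> phi 1 = 1 ->
  (forall z, exists x, phi x = z) ->
  (forall x, phi x = 0 <-> exists w, x = w * g) ->
  1 - e = u * g -> e * g = 0 -> ideal_ring_iso B (ideal_gen [set e]) e.
Proof.
move=> phiD phiM phi1 phi_surj phi_ker e1 eg0.
have phie : phi e = 1.
  rewrite -phi1 -[1 in RHS](subrK e) phiD.
  by rewrite (proj2 (phi_ker (1 - e))) ?add0r //; exists u.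
have ee : e * e = e.
  apply/eqP; rewrite eq_sym -subr_eq0 -{1}[e]mul1r -mulrBl.
  by rewrite e1 -mulrA [g * e]mulrC eg0 mulr0.
have idI := ideal_gen_ideal [set e].
exists phi; split=> //; split=> // [x y /[!inE] Ix Iy xy|z _].
  have phi0 : phi 0 = 0.
    by apply: (addrI (phi 0)); rewrite -phiD !addr0.
  have : phi (x - y) = 0.
    by rewrite phiD xy -phiD subrr.
  move=> /phi_ker[w wE]; apply/eqP; rewrite -subr_eq0.
  have /ideal_gen1E[v vE] := idealB idI Ix Iy.
  by rewrite vE -ee mulrA -vE wE -mulrA [g * e]mulrC eg0 mulr0.
have [x xz] := phi_surj z; exists (x * e); last by rewrite phiM phie mulr1.
by apply/ideal_gen1E; exists x.
Qed.
(** * The quotient by a monic polynomial *)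

Section MonicQuotient.
Variables (R : comNzRingType) (f : {poly R}).
Hypothesis f_monic : f \is monic.
Hypothesis f_size : (1 < size f)%N.
Local Notation Q := {poly %/ f}.
Local Notation q := (in_qpoly f : {poly R} -> Q).

Lemma mk_monicE : mk_monic f = f.
Proof. by rewrite /mk_monic f_size f_monic. Qed.

Lemma in_qpolyK (x : Q) : q (x : {poly R}) = x.
Proof. by apply: val_inj; apply: in_qpoly_small; apply: size_mk_monic. Qed.

Lemma in_qpoly_eq0 (g : {poly R}) : q g = 0 <-> exists w, g = w * f.
Proof.
split=> [/(congr1 val) /=|[w ->]].
  rewrite mk_monicE => g0; exists (Pdiv.CommonRing.rdivp g f).
  by rewrite {1}(Pdiv.RingMonic.rdivp_eq f_monic g) g0 addr0.
by apply: val_inj; rewrite /= mk_monicE Pdiv.RingMonic.rmodp_mull.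
Qed.

End MonicQuotient.

(** * Local rings with maximal ideal generated by a nilpotent integer *)

Section ChainRing.
Variables (p a : nat) (R : comNzRingType) (F : fieldType).
Variable bar : {rmorphism R -> F}.
Hypothesis a_gt0 : (0 < a)%N.
Hypothesis pX_eq0 : forall n, (p%:R ^+ n == 0 :> R) = (a <= n)%N.
Hypothesis barP : is_reduction_mod p bar.

Local Notation "g ^b" := (map_poly bar g) (at level 2, format "g ^b").
Implicit Types (g h : {poly R}).

Lemma bar_eq0 c : bar c = 0 <-> exists d, c = p%:R * d.
Proof.
have [_ ker] := barP; split=> [/ker/ideal_gen1E[d ->]|[d ->]].
  by exists d; rewrite mulrC.
by apply/ker/ideal_gen1E; exists d; rewrite mulrC.
Qed.

(** An inverse modulo [p] lifts: [1 - p * d] is a unit, as [p] is nilpotent. *)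
Lemma bar_unit c : bar c != 0 -> exists d, c * d = 1.
Proof.
move=> c0; have [d dE] := proj1 barP (bar c)^-1.
have /bar_eq0[w wE] : bar (1 - c * d) = 0.
  by rewrite rmorphB rmorphM rmorph1 dE mulfV ?subrr.
have cdE : c * d = 1 - p%:R * w by rewrite -wE opprB addrC subrK.
exists (d * \sum_(i < a) (p%:R * w) ^+ i); rewrite mulrA cdE.
apply: oppr_inj; rewrite -mulNr opprB -subrX1 exprMn.
by move: (pX_eq0 a); rewrite leqnn => /eqP->; rewrite mul0r sub0r.
Qed.

(** Dividing by [p] as long as the quotient is a multiple of [p], one reaches
    [c = p ^ k * d] with [d] a unit, and then [p * c = 0] forces
    [k >= a - 1]. *)
Lemma annihilator_p (c : R) : p%:R * c = 0 -> exists d, c = p%:R ^+ a.-1 * d.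
Proof.
move=> pc0.
suff: forall k, (k <= a.-1)%N -> exists d, c = p%:R ^+ k * d by apply.
elim=> [|k IHk] lek; first by exists c; rewrite mul1r.
have [d cE] := IHk (ltnW lek).
have [/bar_eq0[d' dE]|/bar_unit[d' dd']] := eqVneq (bar d) 0.
  by exists d'; rewrite exprSr -mulrA -dE.
have : p%:R ^+ k.+1 == 0 :> R.
  have -> : p%:R ^+ k.+1 = p%:R * c * d' by rewrite cE exprS -!mulrA dd' mulr1.
  by rewrite pc0 mul0r.
by rewrite pX_eq0 -(prednK a_gt0) ltnS leqNgt lek.
Qed.

(** An element outside [<p>] is a unit, and [p ^ (a - 1) != 0]. *)
Lemma pred_pX_mul_eq0 (c : R) : p%:R ^+ a.-1 * c = 0 <-> bar c = 0.
Proof.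
split=> [pc0|/bar_eq0[d ->]]; last first.
  rewrite mulrA -exprSr prednK //.
  by move: (pX_eq0 a); rewrite leqnn => /eqP->; rewrite mul0r.
apply/eqP/negPn/negP => /bar_unit[d cd].
suff: p%:R ^+ a.-1 == 0 :> R by rewrite pX_eq0 -ltnS prednK // ltnn.
by rewrite -(mulr1 (_ ^+ _)) -[X in _ * X]cd mulrA pc0 mul0r.
Qed.

Lemma poly_coef_dvd c g :
  (forall i, exists d, g`_i = c * d) -> exists d : {poly R}, g = c *: d.
Proof.
move=> /choice[w wE]; exists (\poly_(i < size g) w i).
apply/polyP=> i; rewrite coefZ coef_poly wE; case: ltnP => // /(nth_default 0).
by rewrite -wE mulr0.
Qed.

Lemma natrX_scale k g : p%:R ^+ k * g = p%:R ^+ k *: g.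
Proof. by rewrite -mul_polyC rmorphXn /= polyC_natr. Qed.

Lemma natr_scale g : p%:R * g = p%:R *: g.
Proof. exact: (natrX_scale 1). Qed.

Lemma map_bar_eq0 g : g^b = 0 <-> exists d, g = p%:R * d.
Proof.
split=> [g0|[d ->]]; last first.
  rewrite rmorphM rmorph_nat -polyC_natr -(rmorph_nat bar).
  by rewrite (proj2 (bar_eq0 p%:R)) ?mul0r //; exists 1; rewrite mulr1.
have [|d ->] := @poly_coef_dvd p%:R g; last by exists d; rewrite natr_scale.
by move=> i; apply/bar_eq0; rewrite -coef_map g0 coef0.
Qed.

Lemma map_bar_surj (u : {poly F}) : exists g, g^b = u.
Proof.
have /choice[w wE] i := proj1 barP u`_i.
exists (\poly_(i < size u) w i); apply/polyP => i.
rewrite coef_map coef_poly; case: ltnP => [_|/(nth_default 0) ->].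
  exact: wE.
exact: rmorph0.
Qed.

Lemma dvdp_bar_lift g h : h^b %| g^b -> exists c d, g = c * h + p%:R * d.
Proof.
move=> /dvdpP[u gE]; have [c cE] := map_bar_surj u.
have /map_bar_eq0[d dE] : (g - c * h)^b = 0.
  by rewrite rmorphB rmorphM /= cE gE subrr.
by exists c, d; rewrite -dE addrC subrK.
Qed.

Lemma scale_p_eq0 g : p%:R *: g = 0 -> exists d, g = p%:R ^+ a.-1 * d.
Proof.
move=> pg0; have [|d ->] := @poly_coef_dvd (p%:R ^+ a.-1) g.
  by move=> i; apply: annihilator_p; rewrite -coefZ pg0 coef0.
by exists d; rewrite natrX_scale.
Qed.

Lemma scale_pred_pX_eq0 g : p%:R ^+ a.-1 *: g = 0 <-> g^b = 0.
Proof.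
split=> g0; apply/polyP=> i; have /(congr1 (fun u : {poly _} => u`_i)) := g0;
  rewrite ?coef_map ?coefZ !coef0 => /pred_pX_mul_eq0 //.
Qed.

(** * Ideals of the quotient and divisibility modulo [p] *)

Section Quotient.
Variable f : {poly R}.
Hypothesis f_monic : f \is monic.
Hypothesis f_size : (1 < size f)%N.
Local Notation Q := {poly %/ f}.
Local Notation q := (in_qpoly f : {poly R} -> Q).

Let q_eq0 := in_qpoly_eq0 f_monic f_size.

(** [q g] lies in [<p, h>] iff [g] is a combination of [p], [h] and [f], and
    [f] counts for nothing modulo [p], as its reduction is a multiple of that
    of [h]. *)
Lemma mem_gen_p g h : h^b %| f^b ->
  ideal_gen [set q p%:R; q h] (q g) <-> h^b %| g^b.
Proof.
move=> hf; split=> [/ideal_gen2E[u [v]]|/dvdp_bar_lift[c [d ->]]]; last first.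
  apply/ideal_gen2E; exists (q d), (q c).
  by rewrite rmorphD !rmorphM /= addrC [q d * _]mulrC.
rewrite -(in_qpolyK u) -(in_qpolyK v) -!rmorphM -rmorphD /= => /eqP.
rewrite -subr_eq0 -rmorphB => /eqP/q_eq0[w /(canRL (subrK _)) ->].
rewrite !rmorphD !rmorphM /= dvdp_add ?dvdp_mull //.
rewrite dvdp_add ?dvdp_mull //.
by rewrite (proj2 (map_bar_eq0 p%:R)) ?dvdp0 //; exists 1; rewrite mulr1.
Qed.

(** Multiplication by [p ^ a.-1] embeds [F[x] / <f>] in the quotient, and its
    image is the annihilator of [p] (see [annihilator_p_qpoly]). *)
Lemma pred_pX_qpoly_eq0 g : q (p%:R ^+ a.-1 * g) = 0 <-> f^b %| g^b.
Proof.
rewrite natrX_scale in_qpolyZ.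
split=> [/(congr1 val) /= /scale_pred_pX_eq0|/dvdp_bar_lift[w [d ->]]].
  rewrite (mk_monicE f_monic f_size) => g0.
  rewrite (Pdiv.RingMonic.rdivp_eq f_monic g).
  by rewrite rmorphD rmorphM /= g0 addr0 dvdp_mull.
have /q_eq0 wf0 : exists v, w * f = v * f by exists w.
rewrite in_qpolyD wf0 add0r -in_qpolyZ.
rewrite (proj2 (scale_pred_pX_eq0 _)) ?rmorph0 //.
by apply/map_bar_eq0; exists d.
Qed.

(** Subtracting a multiple of the generator reduces membership to
    [pred_pX_qpoly_eq0], and [h] divides [f] modulo [p]. *)
Lemma mem_gen_pred_pX g h : h^b %| f^b ->
  ideal_gen [set q (p%:R ^+ a.-1 * h)] (q (p%:R ^+ a.-1 * g)) <-> h^b %| g^b.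
Proof.
move=> hf; split=> [/ideal_gen1E[u]|/dvdp_bar_lift[c [d ->]]].
  rewrite -(in_qpolyK u) -rmorphM => /eqP; rewrite -subr_eq0 -rmorphB.
  rewrite mulrCA -mulrBr => /eqP /pred_pX_qpoly_eq0 fgh.
  have := dvdp_trans hf fgh.
  by rewrite rmorphB rmorphM /= dvdp_subl ?dvdp_mull.
have /pred_pX_qpoly_eq0 pd0 : f^b %| (p%:R * d)^b.
  have /map_bar_eq0 -> : exists d', p%:R * d = p%:R * d' by exists d.
  exact: dvdp0.
apply/ideal_gen1E; exists (q c).
by rewrite mulrDr in_qpolyD pd0 addr0 -rmorphM mulrCA.
Qed.

(** The representative of [x] of degree less than that of [f] is itself
    annihilated by [p], so [scale_p_eq0] applies to its coefficients. *)
Lemma annihilator_p_qpoly (x : Q) :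
  q p%:R * x = 0 -> exists g, x = q (p%:R ^+ a.-1 * g).
Proof.
rewrite -{1}(in_qpolyK x) -in_qpolyM natr_scale in_qpolyZ in_qpolyK.
by move=> /(congr1 val) /= /scale_p_eq0[d xE]; exists d; rewrite -xE in_qpolyK.
Qed.

Lemma in_qpoly_p_nilp : q p%:R ^+ a = 0.
Proof.
rewrite -rmorphXn -[_ ^+ a]mulr1 natrX_scale.
by move: (pX_eq0 a); rewrite leqnn => /eqP->; rewrite scale0r rmorph0.
Qed.

(** [q (h ^ n)] is a multiple of [q p], which is nilpotent. *)
Lemma in_qpoly_nilp h n : f^b %| (h ^+ n)^b -> q h ^+ (n * a) = 0.
Proof.
move=> /dvdp_bar_lift[c [d hE]]; rewrite exprM -rmorphXn /= hE.
have /q_eq0 cf0 : exists v, c * f = v * f by exists c.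
by rewrite in_qpolyD cf0 add0r rmorphM exprMn [X in X * _]in_qpoly_p_nilp mul0r.
Qed.

(** * The components of the quotient *)

Section Factors.
Variables (s : nat) (fi h : 'I_s -> {poly R}) (t : 'I_s -> nat).
Hypothesis fE : f = \prod_(i < s) fi i.
Hypothesis fi_monic : forall i, fi i \is monic.
Hypothesis fi_size : forall i, (1 < size (fi i))%N.
Hypothesis fi_coprime : forall i j, i != j -> coprime_elts (fi i) (fi j).
Hypothesis fi_bar : forall i, (fi i)^b = (h i)^b ^+ t i.
Hypothesis h_irr : forall i, irreducible_poly (h i)^b.
Hypothesis t_gt0 : forall i, (0 < t i)%N.

Local Notation fhat := (cofactor_poly fi).
Let H := \prod_(i < s) h i.
Let D := \prod_(i < s) h i ^+ (t i).-1.

Lemma bar_coprime i j : i != j -> coprimep (h i)^b (h j)^b.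
Proof.
move=> /fi_coprime/coprime_eltsP[u [v uv]].
rewrite -(coprimep_pexpl _ _ (t_gt0 i)) -(coprimep_pexpr _ _ (t_gt0 j)).
apply/Bezout_eq1_coprimepP; exists (u^b, v^b) => /=.
by rewrite -!fi_bar -!rmorphM -rmorphD /= uv rmorph1.
Qed.

Lemma f_bar : f^b = \prod_(i < s) (h i)^b ^+ t i.
Proof. by rewrite fE rmorph_prod; apply: eq_bigr => i _; apply: fi_bar. Qed.

Lemma f_bar_HD : f^b = H^b * D^b.
Proof.
rewrite f_bar -rmorphM -big_split /= rmorph_prod; apply: eq_bigr => i _.
by rewrite rmorphM rmorphXn /= -exprS prednK.
Qed.

Lemma h_dvd_H i : (h i)^b %| H^b.
Proof. by rewrite rmorph_prod (bigD1 i) //= dvdp_mulr. Qed.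

Lemma H_dvd_f : H^b %| f^b.
Proof. by rewrite f_bar_HD dvdp_mulr. Qed.

Lemma h_dvd_f i : (h i)^b %| f^b.
Proof. exact: dvdp_trans (h_dvd_H i) H_dvd_f. Qed.

Lemma H_dvdP g : H^b %| g^b <-> forall i, (h i)^b %| g^b.
Proof.
split=> [Hg i|hg]; first exact: dvdp_trans (h_dvd_H i) Hg.
rewrite rmorph_prod /=.
elim: (index_enum _) (index_enum_uniq 'I_s) => [|i r IHr] /=.
  by rewrite big_nil dvd1p.
move=> /andP[ir /IHr rg]; rewrite big_cons Gauss_dvdp ?hg //.
rewrite big_seq; apply: (big_ind (coprimep (h i)^b)) => [|x y|j jr].
    exact: coprimep1.
  by rewrite coprimepMr => ->.
by apply: bar_coprime; apply: contraNneq ir => ->.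
Qed.

Local Notation maxi i := (ideal_gen [set q p%:R; q (h i)]).

(** Modulo [p], an element outside [maxi i] is coprime to the irreducible
    [h i], and a Bezout relation lifts to an inverse modulo [maxi i]. *)
Lemma maxi_maximal i : maximal_ideal (maxi i).
Proof.
apply: maximal_ideal_crit => [||x]; first exact: ideal_gen_ideal.
  rewrite -(in_qpoly1 f) => /(mem_gen_p 1 (h_dvd_f i)).
  by rewrite rmorph1 dvdp1; case: (h_irr i) => /gtn_eqF->.
rewrite -(in_qpolyK x) => /(mem_gen_p _ (h_dvd_f i)) /negP.
rewrite -(irreducible_poly_coprime _ (h_irr i)).
move=> /Bezout_eq1_coprimepP[[u v] /= uv].
have [w wE] := map_bar_surj v; exists (q w).
rewrite -(in_qpoly1 f) -in_qpolyM -rmorphB; apply/(mem_gen_p _ (h_dvd_f i)).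
by rewrite rmorphB rmorph1 rmorphM /= wE -uv addrK dvdp_mull.
Qed.

(** The exponent [T = \sum_i t i] is at least each [t i], so [f] divides
    [H ^ T] modulo [p]. *)
Lemma H_nilp : exists n, q H ^+ n = 0.
Proof.
exists (\sum_i t i * a)%N; rewrite -big_distrl /=; apply: in_qpoly_nilp.
rewrite rmorphXn rmorph_prod -prodrXl f_bar.
pose T := (\sum_i t i)%N.
have -> : \prod_(i < s) (h i)^b ^+ T =
    (\prod_(i < s) (h i)^b ^+ t i) * \prod_(i < s) (h i)^b ^+ (T - t i).
  rewrite -big_split /=; apply: eq_bigr => i _; rewrite -exprD subnKC //.
  by rewrite /T (bigD1 i) //= leq_addr.
exact: dvdp_mulr.
Qed.

(** A maximal ideal contains the nilpotent elements [p] and [\prod_i h i],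
    hence [p] and some [h i]. *)
Lemma maximal_maxi M : maximal_ideal M -> exists i, M = maxi i.
Proof.
move=> maxM; have [idM MT _] := maxM; have [n Hn] := H_nilp.
have [i Mhi] : exists i, M (q (h i)).
  have := maximal_nilpotent maxM Hn; rewrite rmorph_prod /=.
  apply: (big_rec (fun z => M z -> _)) => [/(ideal_full idM)//|i x _ IHx].
  by move=> /(maximal_prime maxM)[Mhi|/IHx//]; exists i.
have maxiM : maxi i `<=` M.
  apply: smallest_sub => // _ [->|->] //.
  exact: maximal_nilpotent maxM in_qpoly_p_nilp.
exists i; have [_ _ maxi_max] := maxi_maximal i.
by have [|] := maxi_max M idM maxiM.
Qed.

Lemma jacobson_cap : jacobson Q = \bigcap_i maxi i.
Proof.
rewrite eqEsubset; split=> x Jx.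
  by move=> i _; apply: Jx (maxi_maximal i).
by move=> M /maximal_maxi[i ->]; apply: Jx.
Qed.

Lemma jacobson_gen : jacobson Q = ideal_gen [set q p%:R; q H].
Proof.
rewrite jacobson_cap; apply/seteqP; split=> x; rewrite -(in_qpolyK x).
  move=> Jx; apply/(mem_gen_p _ H_dvd_f)/H_dvdP => i.
  by apply/(mem_gen_p _ (h_dvd_f i)); exact: Jx.
move=> /(mem_gen_p _ H_dvd_f)/H_dvdP hx i _.
by apply/(mem_gen_p _ (h_dvd_f i)); exact: hx.
Qed.

Local Notation soci i :=
  (ideal_gen [set q (p%:R ^+ a.-1 * h i ^+ (t i).-1 * fhat i)]).

Lemma fhat_bar i : ((h i ^+ (t i).-1 * fhat i)^b * (h i)^b) = f^b.
Proof.
rewrite rmorphM rmorphXn mulrAC -exprSr prednK // -fi_bar -rmorphM fE.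
by rewrite (bigD1 i).
Qed.

Lemma f_bar_neq0 : f^b != 0.
Proof. by rewrite monic_neq0 // monic_map. Qed.

(** An element [p ^ a.-1 * c * h i ^ (t i).-1 * fhat i] vanishes iff [h i]
    divides [c] modulo [p]; otherwise [c] is invertible modulo [p] and [h i],
    both of which annihilate the generator. *)
Lemma soci_minimal i : minimal_ideal (soci i).
Proof.
rewrite -mulrA; move: (h i ^+ _ * _) (fhat_bar i) => G GE.
have G0 : G^b != 0.
  by apply: contraNneq f_bar_neq0 => G0; rewrite -GE G0 mul0r.
have dvdG g : (f^b %| (g * G)^b) = ((h i)^b %| g^b).
  by rewrite -GE rmorphM /= [_ * G^b]mulrC dvdp_mul2l.
apply: minimal_ideal_gen1 => [|c].
  apply/eqP => /pred_pX_qpoly_eq0; rewrite -[G]mul1r dvdG rmorph1 dvdp1.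
  by case: (h_irr i) => /gtn_eqF->.
rewrite -(in_qpolyK c) -in_qpolyM mulrCA => /eqP c0.
have : ~ f^b %| (val c * G)^b by move=> /pred_pX_qpoly_eq0.
rewrite dvdG => /negP; rewrite -(irreducible_poly_coprime _ (h_irr i)).
move=> /Bezout_eq1_coprimepP[[u v] /= uv].
have [w wE] := map_bar_surj v; exists (q w).
rewrite -in_qpolyM (_ : w * _ = p%:R ^+ a.-1 * (w * val c * G)); last by ring.
apply/eqP.
rewrite -subr_eq0 -rmorphB -mulrBr.
apply/eqP/pred_pX_qpoly_eq0; rewrite -{1}[G]mul1r -mulrBl dvdG.
by rewrite rmorphB rmorphM rmorph1 /= wE -uv addrK dvdp_mull.
Qed.

(** Nilpotent elements annihilate minimal ideals; apply this to [p] and to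
    [\prod_i h i]. *)
Lemma socle_sub_gen : socle Q `<=` ideal_gen [set q (p%:R ^+ a.-1 * D)].
Proof.
apply: socle_sub => [|I minI x Ix]; first exact: ideal_gen_ideal.
have [g xE] := annihilator_p_qpoly (minimal_nilpotent minI in_qpoly_p_nilp Ix).
have [n Hn] := H_nilp; have := minimal_nilpotent minI Hn Ix.
rewrite xE -in_qpolyM mulrCA => /pred_pX_qpoly_eq0.
rewrite f_bar_HD rmorphM dvdp_mul2l => [Dg|].
  by apply/mem_gen_pred_pX => //; rewrite f_bar_HD dvdp_mull.
by apply: contraNneq f_bar_neq0 => H0; rewrite f_bar_HD H0 mul0r.
Qed.

Lemma in_qpoly_fhat i : q (fhat i) = \prod_(j | j != i) q (fi j).
Proof. exact: rmorph_prod. Qed.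

Lemma in_qpoly_prod0 : \prod_i q (fi i) = 0.
Proof. by rewrite -rmorph_prod -fE; apply/q_eq0; exists 1; rewrite mul1r. Qed.

Lemma in_qpoly_coprime i j : i != j -> coprime_elts (q (fi i)) (q (fi j)).
Proof.
move=> /fi_coprime/coprime_eltsP[u [v uv]]; apply/coprime_eltsP.
by exists (q u), (q v); rewrite -!rmorphM -rmorphD /= uv rmorph1.
Qed.

Lemma in_qpoly_mul_fhat i : q (fi i) * q (fhat i) = 0.
Proof. by rewrite in_qpoly_fhat mul_cofactor // in_qpoly_prod0. Qed.

Lemma maxi_twist i :
  ideal_gen [set q (p%:R * fhat i + fi i); q (h i * fhat i + fi i)] = maxi i.
Proof.
rewrite !in_qpolyD !in_qpolyM; apply: ideal_gen2_twist.
- rewrite in_qpoly_fhat; apply: coprime_cofactor => j k.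
  exact: in_qpoly_coprime.
- exact: in_qpoly_mul_fhat.
by apply/(mem_gen_p _ (h_dvd_f i)); rewrite fi_bar dvdp_exp.
Qed.

(** Since [fi i] divides [f], reduction modulo [fi i] factors through [Q]. *)
Lemma in_qpoly_val i g : in_qpoly (fi i) (q g) = in_qpoly (fi i) g.
Proof.
apply/eqP; rewrite -subr_eq0 -rmorphB; apply/eqP.
apply/(in_qpoly_eq0 (fi_monic i) (fi_size i)).
have /q_eq0[w ->] : q ((q g : {poly R}) - g) = 0.
  by rewrite rmorphB [X in X - _]in_qpolyK subrr.
by exists (w * fhat i); rewrite fE (bigD1 i) //= -mulrA [_ * fhat i]mulrC.
Qed.

Lemma qpoly_idempotents : exists e : 'I_s -> Q,
  [/\ forall i, e i * e i = e i, forall i j, i != j -> e i * e j = 0,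
      \sum_i e i = 1,
      forall i, ideal_gen [set q (fhat i)] = ideal_gen [set e i]
    & forall i, ideal_ring_iso {poly %/ fi i} (ideal_gen [set e i]) (e i)].
Proof.
have [e [u [v [eE e1 ee eO e_sum]]]] :=
  crt_idempotents in_qpoly_coprime in_qpoly_prod0.
have ge0 i : e i * q (fi i) = 0.
  rewrite eE -in_qpoly_fhat -mulrA [_ (fhat i) * _]mulrC.
  by rewrite in_qpoly_mul_fhat mulr0.
exists e; split=> // i.
  apply: ideal_gen_eq => _ ->; apply/ideal_gen1E; last first.
    by exists (v i); rewrite in_qpoly_fhat.
  exists (q (fhat i)); apply/eqP; rewrite -subr_eq0 -{1}[q _]mulr1 -mulrBr e1.
  by rewrite mulrCA [q (fhat i) * _]mulrC in_qpoly_mul_fhat mulr0.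
apply: (@ideal_ring_iso_idem _ _ (fun x : Q => in_qpoly (fi i) x)
  (e i) (q (fi i)) (u i)) => //.
- by move=> x y; rewrite -in_qpolyD.
- move=> x y; have -> : x * y = q ((x : {poly R}) * y).
    by rewrite in_qpolyM !in_qpolyK.
  by rewrite in_qpoly_val in_qpolyM.
- by rewrite -(in_qpoly1 f) in_qpoly_val in_qpoly1.
- by move=> z; exists (q z); rewrite in_qpoly_val in_qpolyK.
move=> x; split=> [|[w ->]].
  move=> /(in_qpoly_eq0 (fi_monic i) (fi_size i))[w xE].
  by exists (q w); rewrite -in_qpolyM -xE in_qpolyK.
rewrite -(in_qpolyK w) -in_qpolyM in_qpoly_val.
by apply/(in_qpoly_eq0 (fi_monic i) (fi_size i)); exists (val w).
Qed.

Lemma qpoly_components :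
  is_direct_sum (fun i => ideal_gen [set q (fhat i)]) [set: Q] /\
  (forall i, exists e : Q,
     [/\ e * e = e, ideal_gen [set q (fhat i)] = ideal_gen [set e]
       & ideal_ring_iso {poly %/ fi i} (ideal_gen [set q (fhat i)]) e]).
Proof.
have [e [ee eO e_sum eE e_iso]] := qpoly_idempotents.
split=> [|i]; last by exists (e i); rewrite eE; split.
apply: (direct_sum_idem eO ee) => [i|//|x _]; first by rewrite eE.
exists (fun i => x * e i); last by rewrite -mulr_sumr e_sum mulr1.
by move=> i; rewrite eE; apply/ideal_gen1E; exists x.
Qed.

(** Each [e i * (p ^ a.-1 * D)] lies in [soci i], as [e i] is a multiple of
    [fhat i] and [D] one of [h i ^ (t i).-1]. So
    [\sum_i soci i `<=` socle Q `<=` <p ^ a.-1 * D> `<=` \sum_i soci i]. *)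
Lemma socle_components :
  is_direct_sum (fun i => soci i) (socle Q) /\
  socle Q = ideal_gen [set q (p%:R ^+ a.-1 * D)].
Proof.
have [e [ee eO e_sum eE e_iso]] := qpoly_idempotents.
have soci_socle y : (forall i, soci i (y i)) -> socle Q (\sum_i y i).
  move=> Iy; apply: socle_sum => i.
  exact: socle_minimal (soci_minimal i) _ (Iy i).
have gen_soci x : ideal_gen [set q (p%:R ^+ a.-1 * D)] x ->
    exists2 y, forall i, soci i (y i) & x = \sum_i y i.
  move=> /ideal_gen1E[w ->]; set d := q _.
  exists (fun i => w * d * e i); last by rewrite -mulr_sumr e_sum mulr1.
  move=> i; have : ideal_gen [set q (fhat i)] (e i).
    by rewrite eE; apply: mem_ideal_gen1.
  move=> /ideal_gen1E[v ->]; apply/ideal_gen1E.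
  exists (w * v * q (\prod_(j < s | j != i) h j ^+ (t j).-1)).
  rewrite /d /D (bigD1 i) //= !rmorphM /=; ring.
split; last first.
  apply/seteqP; split=> [|x /gen_soci[y Iy ->]]; first exact: socle_sub_gen.
  exact: soci_socle.
apply: (direct_sum_idem eO ee) => [i|//|x /socle_sub_gen/gen_soci//].
rewrite -eE => x /ideal_gen1E[w ->]; apply/ideal_gen1E.
by exists (w * q (p%:R ^+ a.-1 * h i ^+ (t i).-1)); rewrite rmorphM /= mulrA.
Qed.
End Factors.
End Quotient.
End ChainRing.

(** * The factors of the defining polynomial *)

Lemma galois_pX_eq0 (p a m : nat) (R : finComNzRingType) : prime p ->
  is_galois_ring p a m R -> forall n, (p%:R ^+ n == 0 :> R) = (a <= n)%N.
Proof.
by move=> p_prime [charR _ _] n; rewrite -natrX charR dvdn_Pexp2l ?prime_gt1.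
Qed.

Lemma monic_nonunit_size (R : comNzRingType) (g : {poly R}) :
  g \is monic -> ~ is_unit g -> (1 < size g)%N.
Proof.
move=> g_monic; apply: contra_notT; rewrite -leqNgt => /size1_polyC gE.
exists 1; rewrite mulr1; move: g_monic.
by rewrite {}gE monicE lead_coefC => /eqP->.
Qed.

Lemma monic_addl (R : nzRingType) (g d : {poly R}) :
  g \is monic -> (size d < size g)%N -> g + d \is monic.
Proof. by rewrite !monicE => /eqP g1 dg; rewrite lead_coefDl ?g1. Qed.

Lemma size_monic_exp (R : nzRingType) (g : {poly R}) n :
  g \is monic -> size (g ^+ n) = (n * (size g).-1).+1.
Proof.
move=> g_monic; elim: n => [|n IHn]; first by rewrite expr0 size_poly1.
rewrite exprS size_monicM ?monic_neq0 ?monic_exp // IHn addnS /=.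
by rewrite mulSn -{1}(prednK (_ : 0 < size g)%N) ?size_poly_gt0 ?monic_neq0.
Qed.

(* f is monic of positive degree, so {poly %/ f} is R[x]/<f>, with canonical
   projection in_qpoly f; the same holds for every fi i. *)
Theorem theorem5p1
  (p a m : nat) (p_prime : prime p) (a_gt0 : (0 < a)%N) (m_gt0 : (0 < m)%N)
  (R : finComNzRingType) (R_galois : is_galois_ring p a m R)
  (F : fieldType) (bar : {rmorphism R -> F}) (barP : is_reduction_mod p bar)
  (zeta : R) (zetaP : (p ^ m - 1).-primitive_root zeta)
  (s : nat) (s_gt0 : (0 < s)%N)
  (f : {poly R}) (fi h beta : 'I_s -> {poly R}) (t : 'I_s -> nat)
  (f_regular : GRing.lreg f) (f_monic : f \is monic)
  (fE : f = \prod_(i < s) fi i)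
  (fi_regular : forall i, GRing.lreg (fi i))
  (fi_primary : forall i, primary_elt (fi i))
  (fi_coprime : forall i j, i != j -> coprime_elts (fi i) (fi j))
  (fi_nonunit : forall i, ~ is_unit (fi i))
  (fiE : forall i, fi i = h i ^+ t i + p%:R * beta i)
  (h_monic : forall i, h i \is monic)
  (h_irr : forall i, basic_irreducible bar (h i))
  (h_teich : forall i, h i \is a polyOver (teichmuller p m zeta))
  (t_gt0 : forall i, (0 < t i)%N)
  (* deg (beta i) < t i * deg (h i), including beta i = 0 *)
  (beta_deg : forall i, (size (beta i) <= t i * (size (h i)).-1)%N) :
  let Q := {poly %/ f} in
  let q := in_qpoly f : {poly R} -> Q in
  let fhat := cofactor_poly fi in
  [/\ is_direct_sum (fun i => ideal_gen [set q (fhat i)]) [set: Q] /\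
      (forall i, exists e : Q,
         [/\ e * e = e,
             ideal_gen [set q (fhat i)] = ideal_gen [set e]
           & ideal_ring_iso {poly %/ fi i} (ideal_gen [set q (fhat i)]) e]),
      (forall i,
         ideal_gen [set q (p%:R * fhat i + fi i); q (h i * fhat i + fi i)]
         = ideal_gen [set q p%:R; q (h i)]) /\
      (forall M : set Q, maximal_ideal M -> exists i,
         M = ideal_gen [set q (p%:R * fhat i + fi i); q (h i * fhat i + fi i)]),
      jacobson Q = \bigcap_i ideal_gen [set q p%:R; q (h i)] /\
      jacobson Q = ideal_gen [set q p%:R; q (\prod_(i < s) h i)]
    & is_direct_sum
        (fun i => ideal_gen
           [set q (p%:R ^+ a.-1 * h i ^+ (t i).-1 * fhat i)]) (socle Q) /\
      socle Q = ideal_gen [set q (p%:R ^+ a.-1 * \prod_(i < s) h i ^+ (t i).-1)]].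

Proof.
move=> Q q fhat.
have pX := galois_pX_eq0 p_prime R_galois.
have fi_monic i : fi i \is monic.
  rewrite fiE; apply: monic_addl; first exact: monic_exp.
  rewrite size_monic_exp // ltnS; apply: leq_trans (beta_deg i).
  by rewrite natr_scale size_scale_leq.
have fi_size i := monic_nonunit_size (fi_monic i) (fi_nonunit i).
have f_size : (1 < size f)%N.
  apply: monic_nonunit_size => // -[g fg]; case: (fi_nonunit (Ordinal s_gt0)).
  move: fg; rewrite fE (bigD1 (Ordinal s_gt0)) //= -mulrA => fg.
  by eexists; exact: fg.
have fi_bar i : map_poly bar (fi i) = map_poly bar (h i) ^+ t i.
  rewrite fiE rmorphD rmorphXn /=.
  have /(map_bar_eq0 barP) -> : exists d, p%:R * beta i = p%:R * d.
    by exists (beta i).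
  by rewrite addr0.
have h_bar_irr i := proj2 (h_irr i).
have twist := maxi_twist barP f_monic f_size fE fi_coprime fi_bar t_gt0.
split.
- exact: qpoly_components.
- split=> // M maxM.
  have [i ->] :=
    maximal_maxi pX barP f_monic f_size fE fi_bar h_bar_irr t_gt0 maxM.
  by exists i; rewrite twist.
- split; first exact: (jacobson_cap pX barP f_monic f_size fE fi_bar).
  exact: (jacobson_gen pX barP f_monic f_size fE fi_coprime fi_bar).
- exact: (socle_components a_gt0 pX barP f_monic f_size fE fi_monic fi_size
    fi_coprime fi_bar h_bar_irr t_gt0).
Qed.
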